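(* Let $R=N\oplus Q$ be a finite-dimensional complex solvable Leibniz algebra with nilradical $N$, where $Q$ is a vector subspace complementary to $N$, such that $\dim Q=\dim(N/N^2)$. Then $Center(R)=0$.
   Context: All algebras and vector spaces are finite-dimensional over $\mathbb{C}$. A (right) Leibniz algebra is a vector space $L$ with a bilinear bracket satisfying $[[x,y],z]=[[x,z],y]+[x,[y,z]]$ for all $x,y,z\in L$. Put $L^1=L$, $L^{m+1}=[L^m,L]$ and $L^{[1]}=L$, $L^{[m+1]}=[L^{[m]},L^{[m]}]$; $L$ is nilpotent (resp. solvable) if $L^m=0$ (resp. $L^{[m]}=0$) for some $m$. The nilradical is the maximal nilpotent ideal. $Center(L)=\{c\in L : [c,x]=[x,c]=0\ \text{for all } x\in L\}$. *)

(* Defs.v *)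
From HB Require Import structures.
From mathcomp Require Import all_boot all_order all_algebra.
From mathcomp Require Export boolp classical_sets reals complex.

Set Implicit Arguments.
Unset Strict Implicit.
Unset Printing Implicit Defensive.

Import GRing.Theory.

Local Open Scope ring_scope.

(* Finite-dimensional right Leibniz algebras over K: right multiplications     *)
(* are derivations, antisymmetry is not required.                             *)
HB.mixin Record isLeibniz (K : fieldType) L of Vector K L := {
  bracket : L -> L -> L;
  bracket_is_bilinear : bilinear_for *:%R *:%R bracket;
  bracket_leibniz : forall x y z : L,
    bracket (bracket x y) z = bracket (bracket x z) y + bracket x (bracket y z)
}.

#[short(type="leibnizType")]
HB.structure Definition Leibniz (K : fieldType) :=
  {L of isLeibniz K L & Vector K L}.

HB.instance Definition _ (K : fieldType) (L : leibnizType K) :=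
  bilinear_isBilinear.Build K L L L *:%R *:%R (@bracket K L)
    (@bracket_is_bilinear K L).

Section LeibnizTheory.

Variables (K : fieldType) (L : leibnizType K).

Implicit Types (U V W I N : {vspace L}) (m : nat).

(* [U, V] is the linear span of all brackets [u, v] with u in U and v in V;    *)
(* memv_bracketv and bracketv_sub show that the choice of bases is immaterial. *)
Definition bracketv U V : {vspace L} :=
  span [seq bracket u v | u <- vbasis U, v <- vbasis V].

Lemma memv_bracketv U V u v :
  u \in U -> v \in V -> bracket u v \in bracketv U V.
Proof.
move=> /coord_vbasis -> /coord_vbasis ->.
rewrite linear_sumlz; apply: memv_suml => i _.
rewrite linear_sumr; apply: memv_suml => j _.
rewrite linearZl_LR linearZr_LR memvZ // memvZ // memv_span //.
by apply/allpairsP; exists ((vbasis U)`_i, (vbasis V)`_j); rewrite !mem_nth ?size_tuple.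
Qed.

Lemma bracketv_sub U V W :
  reflect (forall u v, u \in U -> v \in V -> bracket u v \in W)
          (bracketv U V <= W)%VS.
Proof.
apply: (iffP idP) => [/subvP sW u v uU vV | sW].
  exact/sW/memv_bracketv.
by apply/span_subvP => _ /allpairsP[[u v] /= [Uu Vv ->]]; apply: sW;
  exact: vbasis_mem.
Qed.

(* U^m and U^[m] for m >= 1, with U^1 = U^[1] = U; the index 0 is a            *)
(* junk value, also equal to U.                                               *)
Definition lower_central U m : {vspace L} :=
  iter m.-1 (fun V => bracketv V U) U.

Definition derived_series U m : {vspace L} :=
  iter m.-1 (fun V => bracketv V V) U.

Definition nilpotent_subspace U : Prop := exists m, lower_central U m = 0%VS.

Definition solvable_subspace U : Prop := exists m, derived_series U m = 0%VS.

Definition two_sided_ideal I : Prop :=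
  (bracketv I fullv <= I)%VS /\ (bracketv fullv I <= I)%VS.

Definition nilpotent_ideal I : Prop :=
  two_sided_ideal I /\ nilpotent_subspace I.

(* N is a nilpotent ideal that is maximal for inclusion; that it contains     *)
(* every nilpotent ideal is not assumed.                                      *)
Definition is_nilradical N : Prop :=
  nilpotent_ideal N /\
  forall I, nilpotent_ideal I -> (N <= I)%VS -> I = N.

Definition center : set L :=
  [set c | forall x, bracket c x = 0 /\ bracket x c = 0]%classic.

End LeibnizTheory.

Arguments center {K} L.

(* The library has no quotient vector spaces: dim (U / V), for V <= U, is the  *)
(* dimension of the complement U :\: V of V in U. It is the dimension of any   *)
(* linear image of U with kernel V.                                           *)
Definition dim_quotient (K : fieldType) (E : vectType K) (U V : {vspace E}) :
  nat := \dim (U :\: V).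

Lemma dim_quotient_limg (K : fieldType) (E F : vectType K) (U V : {vspace E})
    (f : 'Hom(E, F)) :
  (U :&: lker f = V)%VS -> dim_quotient U V = \dim (f @: U).
Proof.
move=> kerV; have VU : (V <= U)%VS by rewrite -kerV capvSl.
have := limg_ker_dim f U; rewrite kerV -(dimv_cap_compl U V).
by move: VU => /capv_idPr -> /addnI.
Qed.

(* Main.v *)
Require Import Defs.
From mathcomp Require Import all_boot all_order all_algebra.
From mathcomp Require Import boolp classical_sets reals complex.
From HB Require Import structures.

(** Why the center vanishes.  Write R_x for the right multiplication
    v |-> [v, x].  The Leibniz identity says two things: R_x is a derivation,
    and x |-> R_x turns brackets into commutators.  Acting on row vectors, so
    that matrices multiply in the order of the brackets, every subquotient of
    L stable under right multiplications is a representation of L.  Lie's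
    theorem ([lie_triangularization]) then makes all R_x triangular at once;
    the diagonal entries, the weights, are linear forms in x which vanish on
    brackets.

    For the representation on L itself, the x on which all weights vanish form
    a nilpotent ideal (Engel) that contains every x with R_x nilpotent, in
    particular N.  By maximality this ideal is N ([nilradical_solvable]).
    Hence [L, L] is contained in N, and R_x is nilpotent only if x lies in N;
    in particular every central element lies in N.

    For the representation on N / N^2 there are k = dim (N / N^2) weights
    alpha_1, ..., alpha_k, and k is also the dimension of Q.  The powers of N
    are generated by N / N^2 and R_x is a derivation, so the generalized
    eigenvalues of R_x on N^m / N^(m+1) are sums of m of the alpha_i(x)
    ([rdev_iter_lower_central] is the case where all alpha_i(x) coincide).
    - If all alpha_i vanish at some x in Q, then R_x is nilpotent on N, hence
      on L since [L, L] lies in N; so x lies in N and in Q, and x = 0.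
    - Therefore the map (alpha_1, ..., alpha_k) from Q to K^k is injective,
      and it is onto because the dimensions agree.  Take x0 in Q with
      alpha_i(x0) = 1 for all i.  The only eigenvalue of R_x0 on N^m / N^(m+1)
      is m, nonzero in characteristic 0, so R_x0 is injective on N.
    A central c lies in N and satisfies [c, x0] = 0, so c = 0. *)

Set Implicit Arguments.
Unset Strict Implicit.
Unset Printing Implicit Defensive.

Import GRing.Theory Num.Theory.

Local Open Scope ring_scope.

(** * Matrices conjugate to triangular ones *)

Section TriangularMatrices.

Variable K : fieldType.

Lemma trig_mulmx_diag n (A B : 'M[K]_n) i :
  is_trig_mx A -> is_trig_mx B -> (A *m B) i i = A i i * B i i.
Proof.
move=> /is_trig_mxP Atrig /is_trig_mxP Btrig.
rewrite mxE (bigD1 i) //= big1 ?addr0 // => j.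
by rewrite neq_ltn => /orP[ji|ij];
  rewrite ?(Btrig _ _ ji) ?(Atrig _ _ ij) ?mulr0 ?mul0r.
Qed.

Lemma trig_mulmx n (A B : 'M[K]_n) :
  is_trig_mx A -> is_trig_mx B -> is_trig_mx (A *m B).
Proof.
move=> /is_trig_mxP Atrig /is_trig_mxP Btrig; apply/is_trig_mxP => i j ij.
rewrite mxE big1 // => k _; have [ik|ki] := ltnP i k.
  by rewrite Atrig // mul0r.
by rewrite Btrig ?mulr0 // (leq_ltn_trans ki).
Qed.

Lemma trig_expmx_diag n (A : 'M[K]_n) m i :
  is_trig_mx A -> is_trig_mx (A ^+ m) /\ (A ^+ m) i i = A i i ^+ m.
Proof.
move=> At; elim: m => [|m [IHt IH]].
  by rewrite !expr0 scalar_mx_is_trig mxE eqxx.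
by rewrite !exprS -IH; split; [exact: trig_mulmx | rewrite -trig_mulmx_diag].
Qed.

Lemma conj_expmx n (P A : 'M[K]_n) m : P \in unitmx ->
  (P *m A *m invmx P) ^+ m = P *m A ^+ m *m invmx P.
Proof.
move=> Pu; elim: m => [|m IH]; first by rewrite !expr0 mulmx1 mulmxV.
by rewrite !exprS IH -!mulmxE !mulmxA mulmxKV.
Qed.

(** A strictly lower triangular matrix pushes the support of a row vector one
    step to the left.  Iterating this kills every row, which is the mechanism
    behind both the nilpotency below and Engel's theorem. *)
Lemma strict_trig_mulmx n (S : 'M[K]_n) (u : 'rV_n) p :
  (forall i j : 'I_n, (i <= j)%N -> S i j = 0) ->
  (forall j : 'I_n, (p < j)%N -> u 0 j = 0) ->
  forall j : 'I_n, (p <= j)%N -> (u *m S) 0 j = 0.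
Proof.
move=> S0 u0 j pj; rewrite mxE big1 // => i _.
have [ij|ji] := leqP i j; first by rewrite S0 // mulr0.
by rewrite u0 ?mul0r // (leq_ltn_trans pj).
Qed.

Lemma trig_nilpotent_diag n (P A : 'M[K]_n) m :
  P \in unitmx -> is_trig_mx (P *m A *m invmx P) -> A ^+ m = 0 ->
  forall i, (P *m A *m invmx P) i i = 0.
Proof.
move=> Pu At A0 i; have [_] := trig_expmx_diag m i At.
rewrite conj_expmx // A0 mulmx0 mul0mx mxE => /esym/eqP.
by rewrite expf_eq0 => /andP[_ /eqP].
Qed.

Lemma trig_const_diag_nilpotent n (P A : 'M[K]_n) c :
  P \in unitmx -> is_trig_mx (P *m A *m invmx P) ->
  (forall i, (P *m A *m invmx P) i i = c) -> (A - c%:M) ^+ n = 0.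
Proof.
move=> Pu; set T := P *m A *m invmx P => /is_trig_mxP Tt Tc.
set S := P *m (A - c%:M) *m invmx P.
have SE : S = T - c%:M.
  by rewrite /S mulmxBr mulmxBl mul_mx_scalar -scalemxAl mulmxV // scalemx1.
clearbody T.
have S0 (i j : 'I_n) : (i <= j)%N -> S i j = 0.
  rewrite SE !mxE leq_eqVlt => /orP[/eqP/val_inj->|ij].
    by rewrite Tc eqxx subrr.
  by rewrite Tt // -val_eqE /= (ltn_eqF ij) subr0.
(* After m factors only the first n - m coordinates can be nonzero. *)
have Sm m (u : 'rV_n) (j : 'I_n) : (n - m <= j)%N -> (u *m S ^+ m) 0 j = 0.
  elim: m j => [|m IH] j; first by rewrite subn0 leqNgt ltn_ord.
  move=> mj; rewrite exprSr -mulmxE mulmxA; move: j mj.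
  apply: strict_trig_mulmx => // j mj; apply: IH.
  by apply: leq_trans mj; rewrite subnS leqSpred.
have : S ^+ n = 0.
  apply/row_matrixP => i; apply/rowP => j.
  by rewrite rowE Sm ?subnn // row0 mxE.
rewrite conj_expmx // => /(congr1 (fun X => invmx P *m X *m P)).
by rewrite !mulmxA mulVmx // mul1mx mulmxKV // mulmx0 mul0mx.
Qed.

End TriangularMatrices.

(** * Eigenvalues and traces on a stable subspace *)

(** The characteristic polynomial splits over a closed field, so it is the one
    of the scalar matrix [a%:M]; the trace is one of its coefficients. *)
Lemma mxtrace_unique_eigenvalue (K : closedFieldType) n (A : 'M[K]_n) a :
  (forall b, eigenvalue A b -> b = a) -> \tr A = a *+ n.
Proof.
case: n A => [|n] A Aa; first by rewrite /mxtrace big_ord0 mulr0n.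
have chA : char_poly A = char_poly (a%:M : 'M_n.+1).
  have [r] := closed_field_poly_normal (char_poly A).
  rewrite (monicP (char_poly_monic A)) scale1r => rE.
  have ra : all (pred1 a) r.
    apply/allP => b br; apply/eqP/Aa; rewrite eigenvalue_root_char rE.
    by rewrite root_prod_XsubC.
  have sr : size r = n.+1.
    by apply: succn_inj; rewrite -(size_char_poly A) rE size_prod_XsubC.
  rewrite rE char_poly_trig ?scalar_mx_is_trig //.
  rewrite (all_pred1P _ _ ra) big_nseq sr -[in LHS](card_ord n.+1) -big_const.
  by apply: eq_bigr => i _; rewrite mxE eqxx.
have := char_poly_trace A (ltn0Sn n); rewrite chA char_poly_trace //.
by move=> /oppr_inj <-; rewrite mxtrace_scalar.
Qed.

(** A stable subspace U is not a type on which the matrix could act.  Instead,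
    the action is read in a basis [row_base U] of U: it is the matrix [Zr] with
    [Zr *m row_base U = row_base U *m Z]. *)
Lemma stable_restriction (K : fieldType) n (U Z : 'M[K]_n) :
  stablemx U Z -> exists Zr, Zr *m row_base U = row_base U *m Z.
Proof.
move=> UZ; exists (row_base U *m Z *m pinvmx (row_base U)).
by rewrite mulmxKpV // (eqmxMr _ (eq_row_base U)) eq_row_base.
Qed.

Lemma mulmx_row_base_neq0 (K : fieldType) n (U : 'M[K]_n) (u : 'rV_(\rank U)) :
  u != 0 -> u *m row_base U != 0.
Proof.
apply: contra => /eqP uB; apply/eqP/(row_free_inj (row_base_free U)).
by rewrite mul0mx.
Qed.

Lemma mulmx_row_base_sub (K : fieldType) n (U : 'M[K]_n) (u : 'rV_(\rank U)) :
  (u *m row_base U <= U)%MS.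
Proof. by apply: submx_trans (submxMl _ _) _; rewrite eq_row_base. Qed.

Lemma stable_eigenvector (K : closedFieldType) n (U Z : 'M[K]_n) :
  U != 0 -> stablemx U Z ->
  exists w a, [/\ w != 0 :> 'rV_n, (w <= U)%MS & w *m Z = a *: w].
Proof.
move=> U0 /stable_restriction[Zr ZrE].
have /closed_rootP[a] : size (char_poly Zr) != 1%N.
  by rewrite size_char_poly eqSS mxrank_eq0.
rewrite -eigenvalue_root_char => /eigenvalueP[u uZ u0].
exists (u *m row_base U), a; split; first exact: mulmx_row_base_neq0.
  exact: mulmx_row_base_sub.
by rewrite -mulmxA -ZrE mulmxA uZ -scalemxAl.
Qed.

(** On U, the commutator H has trace zero and [a] as its only eigenvalue, so
    [a *+ \rank U = 0], and the characteristic is 0. *)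
Lemma commutator_eigenvalue0 (K : numClosedFieldType) n (U X Z : 'M[K]_n) a m
    (H := Z *m X - X *m Z) :
  U != 0 -> stablemx U X -> stablemx U Z -> U *m (H - a%:M) ^+ m = 0 -> a = 0.
Proof.
move=> U0 UX UZ UHa.
have UH : stablemx U H.
  by rewrite stablemxD ?stablemxN; do ?exact: stablemxM.
have [Xr XrE] := stable_restriction UX.
have [Zr ZrE] := stable_restriction UZ.
have [Hr HrE] := stable_restriction UH.
have HrC : Hr = Zr *m Xr - Xr *m Zr.
  move: XrE ZrE HrE (row_base_free U); move: (row_base U) => B XrE ZrE HrE.
  move/row_free_inj; apply; rewrite HrE mulmxBl mulmxBr.
  by rewrite -[Zr *m Xr *m _]mulmxA -[Xr *m Zr *m _]mulmxA XrE ZrE !mulmxA XrE ZrE.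
have : \tr Hr = a *+ \rank U.
  apply: mxtrace_unique_eigenvalue => b /eigenvalueP[u uH /mulmx_row_base_neq0].
  set w := u *m row_base U => w0.
  have wH : w *m (H - a%:M) = (b - a) *: w.
    by rewrite mulmxBr mul_mx_scalar -mulmxA -HrE mulmxA uH -scalemxAl scalerBl.
  have wHm j : w *m (H - a%:M) ^+ j = (b - a) ^+ j *: w.
    elim: j => [|j IH]; first by rewrite !expr0 mulmx1 scale1r.
    by rewrite exprSr -mulmxE mulmxA IH -scalemxAl wH scalerA exprSr.
  have /eqP : w *m (H - a%:M) ^+ m = 0.
    by apply/eqP; rewrite -submx0 -UHa submxMr ?mulmx_row_base_sub.
  by rewrite wHm scaler_eq0 (negPf w0) orbF expf_eq0 subr_eq0 => /andP[_ /eqP].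
rewrite HrC linearB /= mxtrace_mulC subrr => /esym/eqP.
by rewrite mulrn_eq0 mxrank_eq0 (negPf U0) => /eqP.
Qed.

(** * Krylov spaces *)

Section Krylov.

Variable K : fieldType.

Definition krylov n (v : 'rV[K]_n) (Z : 'M[K]_n) j : 'M[K]_n :=
  (\sum_(i < j) <<v *m Z ^+ i>>)%MS.

Lemma krylovS n (v : 'rV[K]_n) Z j :
  krylov v Z j.+1 = (krylov v Z j + <<v *m Z ^+ j>>)%MS.
Proof. by rewrite /krylov big_ord_recr. Qed.

Lemma krylov_mem n (v : 'rV[K]_n) Z i j :
  (i < j)%N -> (v *m Z ^+ i <= krylov v Z j)%MS.
Proof. by move=> ij; rewrite (sumsmx_sup (Ordinal ij)) // genmxE. Qed.

Lemma krylov_mulmx n (v : 'rV[K]_n) Z j :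
  (krylov v Z j *m Z <= krylov v Z j.+1)%MS.
Proof.
rewrite sumsmxMr; apply/sumsmx_subP => i _.
by rewrite (eqmxMr _ (genmxE _)) -mulmxA mulmxE -exprSr krylov_mem // ltnS.
Qed.

(** By Cayley-Hamilton, [v *m Z ^+ n] is a combination of lower powers. *)
Lemma krylov_stable n (v : 'rV[K]_n) Z : stablemx (krylov v Z n) Z.
Proof.
have vZn : (v *m Z ^+ n <= krylov v Z n)%MS.
  case: n v Z => [|m] v A; first by rewrite [_ *m _]thinmx0 sub0mx.
  have /eqP := Cayley_Hamilton A.
  rewrite -[char_poly A]coefK poly_def rmorph_sum /= size_char_poly.
  rewrite big_ord_recr /= addrC addr_eq0 linearZ rmorphXn /= horner_mx_X.
  have /eqP -> : (char_poly A)`_m.+1 == 1.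
    by have := char_poly_monic A; rewrite monicE lead_coefE size_char_poly.
  rewrite scale1r => /eqP ->; rewrite mulmxN eqmx_opp mulmx_sumr.
  apply: summx_sub => i _.
  by rewrite linearZ rmorphXn /= horner_mx_X -scalemxAr scalemx_sub ?krylov_mem.
rewrite sumsmxMr; apply/sumsmx_subP => i _.
rewrite (eqmxMr _ (genmxE _)) -mulmxA mulmxE -exprSr.
by have [->//|iS] := eqVneq i.+1 n; rewrite krylov_mem // ltn_neqAle iS /=.
Qed.

Lemma krylov_neq0 n (v : 'rV[K]_n) Z : v != 0 -> krylov v Z n != 0.
Proof.
move=> v0; have n0 : (0 < n)%N.
  by case: n v v0 {Z} => // v; rewrite (thinmx0 v) eqxx.
apply: contra v0 => /eqP U0; rewrite -submx0 -U0.
by have := krylov_mem v Z n0; rewrite expr0 mulmx1.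
Qed.

End Krylov.

(** * Representations and Lie's theorem *)

(** The bracket goes to the commutator in the order [rho y *m rho z - ...]
    because matrices act on row vectors from the right, as right
    multiplications do. *)
Definition right_rep (K : fieldType) (L : leibnizType K) n (rho : L -> 'M[K]_n) :=
  linear rho /\
  forall y z, rho (bracket y z) = rho y *m rho z - rho z *m rho y.

Definition has_weight_vector (K : fieldType) (L : leibnizType K) n
    (rho : L -> 'M[K]_n) (S : {vspace L}) :=
  exists2 v : 'rV_n, v != 0 & forall x, x \in S -> exists a, v *m rho x = a *: v.

Section Lie.

Variables (K : numClosedFieldType) (L : leibnizType K).

(** If S acts on v by the weight lam, it acts by lam on the whole Krylov space of
    v under [rho z].  The obstruction to moving x past [rho z] is the number
    lam [z, x].  On the Krylov space, the commutator [rho [z, x]] of [rho z] and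
    [rho x] has lam [z, x] as its only eigenvalue, so this number is 0. *)
Lemma weight_krylov n (rho : L -> 'M[K]_n) (S : {vspace L}) z
    (v : 'rV[K]_n) lam :
  right_rep rho -> v != 0 ->
  (forall x, x \in S -> v *m rho x = lam x *: v) ->
  (forall x, x \in S -> bracket z x \in S) ->
  forall x i, x \in S ->
  v *m rho z ^+ i *m rho x = lam x *: (v *m rho z ^+ i).
Proof.
move=> [_ rhoB] v0 vS zS; set Z := rho z.
have comm x : Z *m rho x = rho x *m Z + rho (bracket z x).
  by rewrite rhoB addrC subrK.
(* Modulo the previous Krylov space, x still acts as the scalar lam x. *)
have tri j x : x \in S ->
    (krylov v Z j.+1 *m (rho x - (lam x)%:M) <= krylov v Z j)%MS.
  elim: j x => [|j IH] x xS.
    rewrite krylovS /krylov big_ord0 (eqmxMr _ (adds0mx _ _)).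
    rewrite (eqmxMr _ (genmxE _)) expr0 mulmx1.
    by rewrite mulmxBr vS // mul_mx_scalar subrr sub0mx.
  have mono : (krylov v Z j <= krylov v Z j.+1)%MS by rewrite krylovS addsmxSl.
  rewrite krylovS addsmxMr addsmx_sub (submx_trans (IH x xS) mono) /=.
  rewrite (eqmxMr _ (genmxE _)) exprSr -mulmxE mulmxA.
  set w := v *m Z ^+ j.
  have wj : (w <= krylov v Z j.+1)%MS by rewrite krylov_mem.
  have -> : w *m Z *m (rho x - (lam x)%:M) =
      w *m (rho x - (lam x)%:M) *m Z
      + w *m (rho (bracket z x) - (lam (bracket z x))%:M)
      + lam (bracket z x) *: w.
    rewrite !mulmxBr !mul_mx_scalar mulmxBl -[w *m Z *m rho x]mulmxA comm.
    rewrite mulmxDr mulmxA -scalemxAl -!addrA addNr addr0.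
    by congr (_ + _); rewrite addrC.
  rewrite !addmx_sub ?scalemx_sub //.
    apply: submx_trans (krylov_mulmx v Z j); apply: submxMr.
    by apply: submx_trans (IH x xS); apply: submxMr.
  apply: submx_trans mono; apply: submx_trans (IH _ (zS _ xS)).
  exact: submxMr.
have nil j x : x \in S -> krylov v Z j *m (rho x - (lam x)%:M) ^+ j = 0.
  move=> xS; elim: j => [|j IH]; first by rewrite /krylov big_ord0 mul0mx.
  apply/eqP; rewrite -submx0 -IH exprS -mulmxE mulmxA.
  exact/submxMr/tri.
have lam0 x : x \in S -> lam (bracket z x) = 0.
  move=> xS; have zxS := zS x xS.
  have Ux : stablemx (krylov v Z n) (rho x).
    rewrite -[rho x](subrK (lam x)%:M) stablemxD ?stablemxC //.
    by have := tri n x xS; rewrite krylovS addsmxMr addsmx_sub => /andP[].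
  apply: (commutator_eigenvalue0 (krylov_neq0 Z v0) Ux (krylov_stable v Z)).
  by rewrite -rhoB; apply: nil.
move=> x i; elim: i x => [|i IH] x xS; first by rewrite expr0 mulmx1 vS.
rewrite exprSr -mulmxE mulmxA -mulmxA comm mulmxDr mulmxA IH // IH ?zS //.
by rewrite lam0 // scale0r addr0 -scalemxAl.
Qed.

(** The Krylov space of [weight_krylov] consists of weight vectors for S and is
    stable under [rho z], so it contains an eigenvector of [rho z]. *)
Lemma weight_vector_extend n (rho : L -> 'M[K]_n) (S : {vspace L}) z :
  right_rep rho -> (forall x, x \in S -> bracket z x \in S) ->
  has_weight_vector rho S -> has_weight_vector rho (S + <[z]>)%VS.
Proof.
move=> rhoR zS [v v0 vS].
have /choice[lam vlam] x : exists a, x \in S -> v *m rho x = a *: v.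
  have [/vS[a va]|_] := boolP (x \in S); first by exists a.
  by exists 0.
have wK := weight_krylov rhoR v0 vlam zS.
set U := krylov v (rho z) n.
have [w [a [w0 wU wz]]] :=
  stable_eigenvector (krylov_neq0 (rho z) v0) (krylov_stable v (rho z)).
have Uwt x : x \in S -> U *m (rho x - (lam x)%:M) = 0.
  move=> xS; apply/eqP; rewrite -submx0 sumsmxMr; apply/sumsmx_subP => i _.
  by rewrite (eqmxMr _ (genmxE _)) mulmxBr wK // mul_mx_scalar subrr sub0mx.
exists w => // _ /memv_addP[x xS [_ /vlineP[c ->] ->]].
exists (lam x + c * a).
have -> : rho (x + c *: z) = rho x + c *: rho z.
  by rewrite addrC (proj1 rhoR) addrC.
rewrite mulmxDr -scalemxAr wz scalerA scalerDl; congr (_ + _).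
apply/eqP; rewrite -subr_eq0 -mul_mx_scalar -mulmxBr -submx0 -(Uwt x xS).
exact: submxMr.
Qed.

Lemma bracketvS (U U' V V' : {vspace L}) :
  (U <= U')%VS -> (V <= V')%VS -> (bracketv U V <= bracketv U' V')%VS.
Proof.
move=> /subvP sU /subvP sV; apply/bracketv_sub => u v /sU uU /sV vV.
exact: memv_bracketv.
Qed.

(** Between [D, D] and D every subspace is an ideal of D, so vectors of D can be
    added to it one at a time. *)
Lemma weight_vector_climb n (rho : L -> 'M[K]_n) (D S : {vspace L}) :
  right_rep rho -> (bracketv D D <= S)%VS -> (S <= D)%VS ->
  has_weight_vector rho S -> has_weight_vector rho D.
Proof.
move=> rhoR; move: {2}(\dim D - \dim S)%N (erefl (\dim D - \dim S)%N) => d.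
elim: d S => [|d IH] S dE DD SD wS.
  suff -> : D = S by [].
  by apply/esym/eqP; rewrite eqEdim SD /= -subn_eq0 dE.
have /subvPn[z zD zS] : ~~ (D <= S)%VS.
  by apply/negP => /dimvS; rewrite -subn_eq0 dE.
have SzD : (S + <[z]> <= D)%VS by rewrite subv_add SD -memvE.
apply: (IH (S + <[z]>)%VS) => //.
- rewrite dimv_disjoint_sum ?dim_vline; last first.
    apply/eqP; rewrite -subv0; apply/subvP => x /memv_capP[xS /vlineP[c xc]].
    have [c0|c0] := eqVneq c 0; first by rewrite xc c0 scale0r mem0v.
    by case/negP: zS; rewrite -[z](scalerK c0) -xc memvZ.
  have -> : z != 0 by apply: contra zS => /eqP ->; rewrite mem0v.
  by rewrite addn1 subnS dE.
- by apply: subv_trans DD (addvSl _ _).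
apply: weight_vector_extend => // x xS; apply: (subvP DD).
by apply: memv_bracketv => //; apply: (subvP SD).
Qed.

Lemma derived_seriesS (U : {vspace L}) m :
  derived_series U m.+2 = bracketv (derived_series U m.+1) (derived_series U m.+1).
Proof. by []. Qed.

Lemma derived_series_decr m :
  (derived_series (fullv : {vspace L}) m.+2 <= derived_series fullv m.+1)%VS.
Proof.
elim: m => [|m IH]; first exact: subvf.
by rewrite derived_seriesS [X in (_ <= X)%VS]derived_seriesS bracketvS.
Qed.

(** Lie's theorem: climb the derived series, starting from its zero term, for
    which any nonzero vector will do. *)
Lemma lie_weight_vector n (rho : L -> 'M[K]_n.+1) :
  right_rep rho -> solvable_subspace (fullv : {vspace L}) ->
  has_weight_vector rho fullv.
Proof.
move=> rhoR [m Dm].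
have : has_weight_vector rho (derived_series fullv m).
  rewrite Dm; exists (const_mx 1).
    by apply/negP => /eqP/rowP/(_ 0); rewrite !mxE => /eqP; rewrite oner_eq0.
  move=> x; rewrite memv0 => /eqP ->; exists 0.
  have -> : rho 0 = 0.
    have := proj1 rhoR (-1) 0 0; rewrite scaler0 addr0 scaleN1r addNr.
    exact.
  by rewrite mulmx0 scale0r.
case: m Dm => [|m] _; first by [].
elim: m => [|m IH]; first by [].
move=> w; apply: IH; apply: weight_vector_climb w => //.
exact: derived_series_decr.
Qed.

Lemma lie_triangularization n (rho : L -> 'M[K]_n) :
  right_rep rho -> solvable_subspace (fullv : {vspace L}) ->
  exists2 P, P \in unitmx & forall x, is_trig_mx (P *m rho x *m invmx P).
Proof.
move=> rhoR solL.
suff [P [P' PP' Pt]] : exists P : 'M_n, exists2 P',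
    P *m P' = 1%:M & forall x, is_trig_mx (P *m rho x *m P').
  have [Pu _] := mulmx1_unit PP'; exists P => // x.
  by rewrite -[invmx P]mulmx1 -PP' mulKmx.
elim: n rho rhoR => [|n IH] rho rhoR.
  exists 1%:M; exists 1%:M; first by rewrite mulmx1.
  by move=> x; apply/is_trig_mxP => -[].
have [v v0 vL] := lie_weight_vector rhoR solL.
(* In a basis g whose first row is the weight vector v, the matrices are block
   triangular, and their lower right blocks are again a representation. *)
pose e : 'rV[K]_(1 + n) := row_mx 1%:M 0.
have [g gu eg] : {g | g \in unitmx & e *m g = v}.
  have ev : e *m (col_mx v 0 : 'M_(1 + n)) = v.
    by rewrite mul_row_col mul1mx mul0mx addr0.
  have [|g gu eg] := @complete_unitmx _ _ _ e (col_mx v 0).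
    have e0 : e != 0 by apply: contra v0 => /eqP e0; rewrite -ev e0 mul0mx.
    by rewrite ev !rank_rV v0 e0.
  by exists g => //; rewrite -eg.
pose M x : 'M_(1 + n) := g *m rho x *m invmx g.
have Mur x : ursubmx (M x) = 0.
  have [a va] := vL x (memvf x).
  have : e *m M x = a *: e.
    by rewrite /M !mulmxA eg va -scalemxAl -eg mulmxK.
  rewrite -[M x in LHS](@submxK _ 1 n 1 n) /e mul_row_block !mul1mx !mul0mx !addr0.
  by rewrite scale_row_mx scaler0 => /eq_row_mx[].
have ME x : M x = block_mx (ulsubmx (M x)) 0 (dlsubmx (M x)) (drsubmx (M x)).
  by rewrite -[LHS](@submxK _ 1 n 1 n) Mur.
have drP a (A B : 'M[K]_(1 + n)) :
    drsubmx (a *: A + B) = a *: drsubmx A + drsubmx B.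
  by apply/matrixP => i j; rewrite !mxE.
have drM x y : drsubmx (M x *m M y) = drsubmx (M x) *m drsubmx (M y).
  by rewrite {1}(ME x) {1}(ME y) mulmx_block block_mxKdr mulmx0 add0r.
have [|P [P' PP' Pt]] := IH (fun x => drsubmx (M x)).
  split=> [a x y|y z].
    by rewrite -drP /M (proj1 rhoR) mulmxDr mulmxDl -scalemxAr -scalemxAl.
  have -> : M (bracket y z) = (- 1) *: (M z *m M y) + M y *m M z.
    rewrite /M (proj2 rhoR) mulmxBr mulmxBl !mulmxA !(mulmxKV gu).
    by rewrite scaleN1r addrC.
  by rewrite drP !drM scaleN1r addrC.
exists (block_mx 1%:M 0 0 P *m g); exists (invmx g *m block_mx 1%:M 0 0 P').
  rewrite -mulmxA (mulKVmx gu) (@mulmx_block _ 1 n 1 n 1 n).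
  rewrite !mulmx0 !mul0mx !mul1mx !addr0 add0r.
  by rewrite PP' -scalar_mx_block.
move=> x.
have -> : block_mx 1%:M 0 0 P *m g *m rho x *m (invmx g *m block_mx 1%:M 0 0 P') =
    block_mx 1%:M 0 0 P *m M x *m block_mx 1%:M 0 0 P'.
  by rewrite /M !mulmxA.
rewrite ME !(@mulmx_block _ 1 n 1 n 1 n).
rewrite !mulmx0 !mul0mx !mulmx1 !mul1mx !addr0 !add0r !mul0mx.
by rewrite (@is_trig_block_mx _ 1 n 1 n) // eqxx mx11_is_trig Pt.
Qed.

End Lie.

(** * Representations on subquotients *)

Lemma linear_hom (K : fieldType) (U V : vectType K) (f : U -> V) :
  linear f -> exists g : 'Hom(U, V), g =1 f.
Proof.
move=> flin.
pose f' : {linear U -> V} := HB.pack f (GRing.isLinear.Build _ _ _ _ f flin).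
by exists (linfun f') => u; rewrite lfunE.
Qed.

Section Leibniz.

Variables (K : fieldType) (L : leibnizType K).

(** B / A is modelled by the complement [B :\: A] in its basis: [pi] is the
    projection onto it along A followed by coordinates. *)
Lemma quotient_rep (A B : {vspace L}) :
  (A <= B)%VS -> (bracketv A fullv <= A)%VS -> (bracketv B fullv <= B)%VS ->
  exists (pi : 'Hom(L, 'rV[K]_(\dim (B :\: A)))) rho,
  [/\ right_rep rho,
      forall v, v \in B -> (pi v == 0) = (v \in A),
      forall u, exists2 v, v \in B & pi v = u
    & forall v x, v \in B -> pi (bracket v x) = pi v *m rho x].
Proof.
move=> AB /bracketv_sub Aid /bracketv_sub Bid.
set C := (B :\: A)%VS; set X := vbasis C; set p := daddv_pi C A.
have CA0 : (C :&: A = 0)%VS by exact: capv_diff.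
have CB : (C <= B)%VS by exact: diffvSl.
have pA a : a \in A -> p a = 0.
  move=> aA; have := daddv_pi_add CA0 (subvP (addvSr C A) a aA).
  rewrite (@daddv_pi_id _ _ A C a) //; last by rewrite capvC.
  by move/(canRL (addrK _)); rewrite subrr.
have pB v : v \in B -> exists2 a, a \in A & v = p v + a.
  move=> vB; exists (daddv_pi A C v); first exact: memv_pi.
  by rewrite daddv_pi_add // addv_diff (subvP (addvSl B A)).
have [pi piE] : exists pi : 'Hom(L, 'rV[K]_(\dim C)),
    pi =1 fun v => \row_i coord X i (p v).
  apply: linear_hom => a u v; apply/rowP => i.
  by rewrite !mxE linearP linearP.
pose rho x : 'M[K]_(\dim C) := \matrix_(i, j) coord X j (p (bracket X`_i x)).
have piA v : v \in B -> (pi v == 0) = (v \in A).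
  move=> vB; rewrite piE; apply/eqP/idP => [pv0|/pA pv0]; last first.
    by apply/rowP => i; rewrite !mxE pv0 linear0.
  have [a aA ->] := pB v vB.
  suff -> : p v = 0 by rewrite add0r.
  rewrite (coord_vbasis (memv_pi C A v)) big1 // => i _.
  by move/rowP/(_ i): pv0; rewrite !mxE => ->; rewrite scale0r.
have piM v x : v \in B -> pi (bracket v x) = pi v *m rho x.
  move=> vB; have [a aA vE] := pB v vB.
  have -> : pi (bracket v x) = pi (bracket (p v) x).
    have /eqP pax : pi (bracket a x) == 0.
      have axA : bracket a x \in A by rewrite Aid ?memvf.
      by rewrite piA // (subvP AB).
    by rewrite [in LHS]vE linearDl linearD /= pax addr0.
  apply/rowP => j; rewrite !piE !mxE.
  rewrite [p v in LHS](coord_vbasis (memv_pi C A v)) linear_sumlz !linear_sum /=.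
  by apply: eq_bigr => i _; rewrite linearZl_LR !linearZ !mxE.
have pisurj u : exists2 v, v \in B & pi v = u.
  have memC : (\sum_i u 0 i *: X`_i) \in C.
    by apply: memv_suml => i _; rewrite memvZ // vbasis_mem // mem_nth ?size_tuple.
  exists (\sum_i u 0 i *: X`_i); first exact: (subvP CB).
  apply/rowP => i; rewrite piE mxE /p daddv_pi_id //.
  by rewrite coord_sum_free // (basis_free (vbasisP C)).
exists pi; exists rho; split=> //; split=> [a x y|y z].
  by apply/matrixP => i j; rewrite !mxE linearPr !linearP.
apply/row_matrixP => i; rewrite !rowE.
have [v vB <-] := pisurj (delta_mx 0 i).
have vxB x : bracket v x \in B by rewrite Bid ?memvf.
rewrite mulmxBr !mulmxA -!piM // -linearB /= bracket_leibniz.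
by rewrite addrC addKr.
Qed.

(** The injection [pi] gives coordinates to the vectors of L.  In the basis that
    makes the representation triangular, a bracket with an element of T shortens
    the support of the coordinates by one. *)
Lemma engel_nilpotent n (pi : 'Hom(L, 'rV[K]_n)) rho P (T : {vspace L}) :
  (forall v, pi v = 0 -> v = 0) ->
  (forall v x, pi (bracket v x) = pi v *m rho x) ->
  P \in unitmx -> (forall x, is_trig_mx (P *m rho x *m invmx P)) ->
  (forall x, x \in T -> forall i, (P *m rho x *m invmx P) i i = 0) ->
  nilpotent_subspace T.
Proof.
move=> pi0 piM Pu Pt T0; exists n.+1.
have van m (u : L) (j : 'I_n) : u \in lower_central T m.+1 -> (n - m <= j)%N ->
    (pi u *m invmx P) 0 j = 0.
  elim: m u j => [|m IH] u j uT mj; first by rewrite subn0 leqNgt ltn_ord in mj.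
  have [f fE] : exists f : 'Hom(L, 'rV[K]_1),
      f =1 fun w => const_mx ((pi w *m invmx P) 0 j).
    apply: linear_hom => a w w'; apply/rowP => i.
    by rewrite linearP mulmxDl -scalemxAl !mxE.
  suff /subvP/(_ _ uT) : (lower_central T m.+2 <= lker f)%VS.
    by rewrite memv_ker fE => /eqP/rowP/(_ 0); rewrite !mxE.
  apply/bracketv_sub => w x wT xT; rewrite memv_ker fE piM.
  have -> : pi w *m rho x *m invmx P = pi w *m invmx P *m (P *m rho x *m invmx P).
    by rewrite !mulmxA mulmxKV.
  rewrite (@strict_trig_mulmx _ _ _ _ (n - m.+1)) //.
  - move=> i i'; rewrite leq_eqVlt => /orP[/eqP/val_inj->|]; first exact: T0.
    exact: (is_trig_mxP (Pt x)).
  - by move=> i mi; apply: IH => //; apply: leq_trans mi; rewrite subnS leqSpred.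
apply/eqP; rewrite -subv0; apply/subvP => u uT; rewrite memv0; apply/eqP/pi0.
have piP : pi u *m invmx P = 0.
  by apply/rowP => j; rewrite (van n) ?subnn // mxE.
by rewrite -[pi u](mulmxKV Pu) piP mul0mx.
Qed.

(** * Right multiplications on the powers of an ideal *)

(** R_x - c: its iterates test generalized eigenvectors of R_x for c. *)
Definition rdev c (x v : L) := bracket v x - c *: v.

Lemma rdev0 x v : rdev 0 x v = bracket v x.
Proof. by rewrite /rdev scale0r subr0. Qed.

Lemma rdev_iter_linear c x m : linear (iter m (rdev c x)).
Proof.
move=> a u v; elim: m => //= m ->; rewrite /rdev linearDl linearZl_LR.
by rewrite scalerDr !scalerBr opprD !scalerA mulrC addrACA.
Qed.

Lemma rdev_iterD c x m u v :
  iter m (rdev c x) (u + v) = iter m (rdev c x) u + iter m (rdev c x) v.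
Proof. by have := rdev_iter_linear c x m 1 u v; rewrite !scale1r. Qed.

Lemma rdev_iter_mem (B : {vspace L}) c x m v :
  (bracketv B fullv <= B)%VS -> v \in B -> iter m (rdev c x) v \in B.
Proof.
move=> /bracketv_sub BL vB; elim: m => //= m IH.
by rewrite memvB ?memvZ ?BL ?memvf.
Qed.

Lemma rdev_rep n (B : {vspace L}) (pi : 'Hom(L, 'rV[K]_n)) rho c x m v :
  (bracketv B fullv <= B)%VS ->
  (forall v x, v \in B -> pi (bracket v x) = pi v *m rho x) -> v \in B ->
  pi (iter m (rdev c x) v) = pi v *m (rho x - c%:M) ^+ m.
Proof.
move=> BL piM vB; elim: m => [|m IH] /=; first by rewrite expr0 mulmx1.
rewrite exprSr -mulmxE mulmxA -IH /rdev linearB linearZ /=.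
by rewrite piM ?rdev_iter_mem // mulmxBr mul_mx_scalar.
Qed.

Lemma lower_centralS (U : {vspace L}) m :
  lower_central U m.+2 = bracketv (lower_central U m.+1) U.
Proof. by []. Qed.

Lemma lower_central_ideal (N : {vspace L}) m :
  (bracketv N fullv <= N)%VS ->
  (bracketv (lower_central N m) fullv <= lower_central N m)%VS.
Proof.
move=> NL; case: m => [//|m]; elim: m => [//|m /bracketv_sub IH].
have /bracketv_sub NL' := NL.
apply/bracketv_sub => w x wN _.
have [f fE] : exists f : 'Hom(L, L), f =1 (fun w => bracket w x).
  by apply: linear_hom => a u v; rewrite linearPl.
suff /subvP/(_ _ wN) : (lower_central N m.+2 <= f @^-1: lower_central N m.+2)%VS.
  by rewrite -memv_preim fE.
apply/bracketv_sub => u v uN vN; rewrite -memv_preim fE bracket_leibniz.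
by rewrite memvD // memv_bracketv ?IH ?NL' ?memvf.
Qed.

(** The powers are taken by right multiplication with N, yet [N^m, N^2] lies in
    N^(m+2): by the Leibniz identity a right bracket with [p, q] is a commutator
    of right brackets with p and q. *)
Lemma bracket_lower_central2 (N : {vspace L}) m u v :
  u \in lower_central N m.+1 -> v \in lower_central N 2 ->
  bracket u v \in lower_central N m.+3.
Proof.
move=> uN vN.
have [f fE] : exists f : 'Hom(L, L), f =1 bracket u.
  by apply: linear_hom => a w w'; rewrite linearPr.
suff /subvP/(_ _ vN) : (lower_central N 2 <= f @^-1: lower_central N m.+3)%VS.
  by rewrite -memv_preim fE.
apply/bracketv_sub => p q pN qN; rewrite -memv_preim fE.
have -> : bracket u (bracket p q) =
    bracket (bracket u p) q - bracket (bracket u q) p.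
  by rewrite bracket_leibniz addrC addKr.
by rewrite memvB // !lower_centralS !memv_bracketv.
Qed.

(** R_x is a derivation, so eigenvalues add up under brackets. *)
Lemma rdev_bracket c d x u v :
  rdev (c + d) x (bracket u v) = bracket (rdev c x u) v + bracket u (rdev d x v).
Proof.
rewrite /rdev bracket_leibniz linearBl linearBr linearZl_LR linearZr_LR.
by rewrite scalerDl opprD addrACA.
Qed.

(** Each application of [rdev_bracket] advances u or v, so after [a + b] of them
    u has reached N^(m+2) or v has reached N^2 in every term. *)
Lemma rdev_iter_bracket (N : {vspace L}) m c d x a b u v :
  (bracketv N fullv <= N)%VS ->
  u \in lower_central N m.+1 -> v \in N ->
  iter a (rdev c x) u \in lower_central N m.+2 ->
  iter b (rdev d x) v \in lower_central N 2 ->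
  iter (a + b) (rdev (c + d) x) (bracket u v) \in lower_central N m.+3.
Proof.
move=> NL; have idl l := lower_central_ideal l NL.
have step l y w e : w \in lower_central N l -> rdev e y w \in lower_central N l.
  by move=> wl; apply: (@rdev_iter_mem _ e y 1 w (idl l)).
elim: a b u v => [|a IHa] b u v uN vN uc.
  by move=> _; apply: rdev_iter_mem (idl _) _; apply: memv_bracketv.
elim: b v vN => [|b IHb] v vN vd.
  by apply: rdev_iter_mem (idl _) _; apply: bracket_lower_central2.
rewrite addSn iterSr rdev_bracket rdev_iterD memvD //.
  by apply: IHa; rewrite -?iterSr //; apply: step.
by rewrite addnS -addSn; apply: IHb; rewrite -?iterSr //; apply: (step 1).
Qed.

(** If c is the only eigenvalue of R_x on N / N^2, then m c is the only one on
    N^m / N^(m+1), by induction on m from [rdev_iter_bracket]. *)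
Lemma rdev_iter_lower_central (N : {vspace L}) c x :
  (bracketv N fullv <= N)%VS ->
  (exists k, forall v, v \in N -> iter k (rdev c x) v \in lower_central N 2) ->
  forall m, exists k, forall u, u \in lower_central N m.+1 ->
    iter k (rdev (c *+ m.+1) x) u \in lower_central N m.+2.
Proof.
move=> NL [k0 Hk0]; elim=> [|m [k IH]]; first by exists k0.
exists (k + k0)%N => u uN.
have [f fE] := linear_hom (rdev_iter_linear (c *+ m.+2) x (k + k0)).
rewrite -fE memv_preim; move: u uN; apply/subvP/bracketv_sub => u v uN vN.
rewrite -memv_preim fE mulrSr; apply: rdev_iter_bracket => //.
  exact: IH.
exact: Hk0.
Qed.

Lemma rdev_nilpotent_on (N : {vspace L}) x :
  (bracketv N fullv <= N)%VS -> nilpotent_subspace N ->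
  (exists k, forall v, v \in N -> iter k (rdev 0 x) v \in lower_central N 2) ->
  exists k, forall v, v \in N -> iter k (rdev 0 x) v = 0.
Proof.
move=> NL [m Nm] Hk.
suff [k H] : exists k, forall v, v \in N ->
    iter k (rdev 0 x) v \in lower_central N m.
  by exists k => v /H; rewrite Nm memv0 => /eqP.
case: m {Nm} => [|m]; first by exists 0.
elim: m => [|m [k IH]]; first by exists 0.
have [k' H] := rdev_iter_lower_central NL Hk m.
exists (k' + k)%N => v /IH vk; rewrite iterD; have := H _ vk.
by rewrite mul0rn.
Qed.

End Leibniz.

(** If 1 is the only eigenvalue of R_x on N / N^2, then on N^m / N^(m+1) it is m,
    which is nonzero.  So a vector of N killed by R_x lies in every power of N. *)
Lemma rdev_eq0_on (K : numFieldType) (L : leibnizType K) (N : {vspace L}) x :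
  (bracketv N fullv <= N)%VS -> nilpotent_subspace N ->
  (exists k, forall v, v \in N -> iter k (rdev 1 x) v \in lower_central N 2) ->
  forall c, c \in N -> bracket c x = 0 -> c = 0.
Proof.
move=> NL [m Nm] Hk c cN cx.
suff : c \in lower_central N m by rewrite Nm memv0 => /eqP.
case: m {Nm} => [//|m]; elim: m => [//|m IH].
have [k /(_ c IH)] := rdev_iter_lower_central NL Hk m.
have -> j : iter j (rdev (1 *+ m.+1) x) c = (- (1 *+ m.+1)) ^+ j *: c.
  elim: j => [|j /= ->]; first by rewrite expr0 scale1r.
  by rewrite /rdev linearZl_LR /= cx scaler0 sub0r exprS -scalerA scaleNr.
have cN0 : (- (1 *+ m.+1)) ^+ k != 0 :> K.
  by rewrite expf_neq0 // oppr_eq0 pnatr_eq0.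
by move/(memvZ ((- (1 *+ m.+1)) ^+ k)^-1); rewrite scalerK.
Qed.

(** * The nilradical and the weights of a solvable algebra *)

Section Solvable.

Variables (K : numClosedFieldType) (L : leibnizType K).

Definition right_nilpotent (x : L) := exists m, forall v, iter m (rdev 0 x) v = 0.

Lemma nilpotent_ideal_right_nilpotent (N : {vspace L}) x :
  nilpotent_ideal N -> x \in N -> right_nilpotent x.
Proof.
move=> [[_ /bracketv_sub NL] [m Nm]] xN; exists m.+1 => v.
have : iter m.+1 (rdev 0 x) v \in lower_central N m.
  case: m {Nm} => [|m]; first by rewrite /= rdev0 NL ?memvf.
  elim: m => [|m IH] /=; first by rewrite !rdev0 NL ?memvf.
  rewrite rdev0; apply: memv_bracketv => //; exact: IH.
by rewrite Nm memv0 => /eqP.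
Qed.

(** The common kernel T of all weights of L contains all brackets, hence is an
    ideal; it is nilpotent by Engel and contains every right nilpotent element,
    hence N, because R_x maps L to N and N^m to N^(m+1) for x in N.  By maximality
    T = N. *)
Lemma nilradical_solvable (N : {vspace L}) :
  solvable_subspace (fullv : {vspace L}) -> is_nilradical N ->
  (forall x y, bracket x y \in N) /\ (forall x, right_nilpotent x -> x \in N).
Proof.
move=> solL [Nnil Nmax].
have [] := @quotient_rep K L 0 fullv.
- exact: subvf.
- by apply/bracketv_sub => u v; rewrite memv0 => /eqP -> _; rewrite linear0l mem0v.
- exact: subvf.
set n := \dim _ => pi [rho [rhoR pi0 pisurj piM]].
have [P Pu Pt] := lie_triangularization rhoR solL.
pose D x := P *m rho x *m invmx P.
have [f fE] : exists f : 'Hom(L, 'rV[K]_n), f =1 fun x => \row_i D x i i.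
  apply: linear_hom => a x y; apply/rowP => i.
  by rewrite /D (proj1 rhoR) mulmxDr mulmxDl -scalemxAr -scalemxAl !mxE.
have fP x : reflect (forall i, D x i i = 0) (x \in lker f).
  rewrite memv_ker fE; apply: (iffP eqP) => [/rowP f0 i|f0].
    by move: (f0 i); rewrite !mxE.
  by apply/rowP => i; rewrite mxE f0 mxE.
have brT x y : bracket x y \in lker f.
  apply/fP => i.
  have -> : D (bracket x y) = D x *m D y - D y *m D x.
    by rewrite /D (proj2 rhoR) mulmxBr mulmxBl !mulmxA !(mulmxKV Pu).
  rewrite mxE [X in _ + X]mxE.
  rewrite (trig_mulmx_diag i (Pt x) (Pt y)) (trig_mulmx_diag i (Pt y) (Pt x)).
  by rewrite mulrC subrr.
have nilT x : right_nilpotent x -> x \in lker f.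
  move=> [m xm]; apply/fP; apply: (@trig_nilpotent_diag _ _ _ _ m) => //.
  apply/row_matrixP => i; rewrite rowE row0.
  have [v _ <-] := pisurj (delta_mx 0 i).
  have := @rdev_rep _ _ _ fullv pi rho 0 x m v (subvf _) piM (memvf v).
  by rewrite raddf0 subr0 xm linear0.
suff <- : lker f = N by [].
apply: Nmax; last first.
  by apply/subvP => x xN; apply/nilT/(nilpotent_ideal_right_nilpotent Nnil).
split; first by split; apply/bracketv_sub.
apply: (@engel_nilpotent _ _ _ pi rho P) => //.
- by move=> v /eqP; rewrite pi0 ?memvf // memv0 => /eqP.
- by move=> v x; rewrite piM ?memvf.
- by move=> x /fP.
Qed.

(** The weights of N / N^2.  If they take one common value c at x, then c is the
    only eigenvalue of R_x there. *)
Lemma weights_mod_square (N : {vspace L})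
    (k := dim_quotient N (lower_central N 2)) :
  solvable_subspace (fullv : {vspace L}) -> (bracketv N fullv <= N)%VS ->
  exists alpha : 'Hom(L, 'rV[K]_k), forall x c, alpha x = const_mx c ->
    forall v, v \in N -> iter k (rdev c x) v \in lower_central N 2.
Proof.
move=> solL NL.
have [] := @quotient_rep _ _ (lower_central N 2) N.
- by apply: subv_trans NL; apply: bracketvS (subvf _).
- exact: lower_central_ideal.
- exact: NL.
rewrite -/(dim_quotient _ _) -/k => pi [rho [rhoR pi0 _ piM]].
have [P Pu Pt] := lie_triangularization rhoR solL.
pose D x := P *m rho x *m invmx P.
have [alpha alphaE] : exists f : 'Hom(L, 'rV[K]_k), f =1 fun x => \row_i D x i i.
  apply: linear_hom => a x y; apply/rowP => i.
  by rewrite /D (proj1 rhoR) mulmxDr mulmxDl -scalemxAr -scalemxAl !mxE.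
exists alpha => x c /rowP xc v vN.
rewrite -pi0 ?rdev_iter_mem // (rdev_rep _ _ _ NL piM vN).
rewrite (trig_const_diag_nilpotent Pu (Pt x) (c := c)) ?mulmx0 // => i.
by move: (xc i); rewrite alphaE [LHS]mxE [RHS]mxE.
Qed.

(** The equality of dimensions provides the x0 in Q on which all the weights of N / N^2
    are 1; right multiplication by x0 detects every central element. *)
Lemma center_eq0 (N Q : {vspace L}) :
  solvable_subspace (fullv : {vspace L}) -> is_nilradical N ->
  (N :&: Q = 0)%VS -> \dim Q = dim_quotient N (lower_central N 2) ->
  center L = [set 0]%classic.
Proof.
move=> solL Nrad NQ0 dimQ.
have [brN nilN] := nilradical_solvable solL Nrad.
have [[[NL _] Nnil] _] := Nrad.
have [alpha alphaP] := weights_mod_square solL NL.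
(* An x in Q killed by all weights of N / N^2 is right nilpotent, so it is in N. *)
have Qinj : (Q :&: lker alpha = 0)%VS.
  apply/eqP; rewrite -subv0; apply/subvP => x /memv_capP[xQ].
  rewrite memv_ker => /eqP alpha0; rewrite -NQ0 memv_cap xQ andbT.
  have [|k xk] := @rdev_nilpotent_on _ _ N x NL Nnil.
    by eexists; apply: alphaP; rewrite alpha0; apply/rowP => i; rewrite !mxE.
  apply: nilN; exists k.+1 => v.
  by rewrite iterSr xk // rdev0.
have alphaQ : (alpha @: Q = fullv)%VS.
  apply/eqP; rewrite eqEdim subvf limg_dim_eq // dimQ dimvf.
  by rewrite /dim /= mul1n.
have [x0 _ x01] : exists2 x, x \in Q & const_mx 1 = alpha x.
  by apply/memv_imgP; rewrite alphaQ memvf.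
apply/seteqP; split=> [c cZ|_ ->] /=; last first.
  by move=> x; rewrite linear0l linear0r.
apply: (@rdev_eq0_on _ _ N x0) => //; last exact: (cZ x0).1.
  by eexists; apply: alphaP; rewrite x01.
by apply: nilN; exists 1%N => v; rewrite /= rdev0 (cZ v).2.
Qed.

End Solvable.

Theorem proposition6p1 (R : realType) (L : leibnizType R[i])
    (N Q : {vspace L})
    (L_solvable : solvable_subspace (fullv : {vspace L}))
    (N_nilradical : is_nilradical N)
    (NQ_sum : (N + Q = fullv)%VS)
    (NQ_direct : (N :&: Q = 0)%VS)
    (dimQ : \dim Q = dim_quotient N (lower_central N 2)) :
  center L = [set 0]%classic.
Proof. exact: center_eq0 L_solvable N_nilradical NQ_direct dimQ. Qed.
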